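(* Let $R$ be a commutative finite chain ring with maximal ideal $\gamma R$, nilpotency index $e$, residue field $\mathbb{F}_q$, and let $n\ge 1$. Then $$\bigl|ST_n(R,0)\bigr|=q^{e(2n-1)}-|IST_n(R)|-\sum_{s=1}^{e-1}\Bigl(q^{(e-s)(2n-1)}\bigl|ST_n(R/\gamma^sR,0)\bigr|-q^{(e-s-1)(2n-1)}\bigl|ST_n(R/\gamma^{s+1}R,0)\bigr|\Bigr).$$
   Context: A commutative finite chain ring is a finite commutative ring $R$ with identity $1\ne 0$ whose ideals are totally ordered under inclusion. It has a unique maximal ideal, which is principal, generated by $\gamma$; the nilpotency index $e$ of $R$ is the least positive integer with $\gamma^e=0$, and the residue field is $R/\gamma R\cong\mathbb{F}_q$, a finite field with $q$ elements. For a commutative ring $T$ with identity, $U(T)$ is its group of units; for $n\ge 1$, $ST_n(T)$ is the set of $n\times n$ symmetric tridiagonal matrices over $T$, i.e. symmetric matrices whose entries outside the main diagonal, the subdiagonal and the superdiagonal are zero; $ST_n(T,c)=\{A\in ST_n(T):\det(A)=c\}$ for $c\in T$; and $IST_n(T)=\{A\in ST_n(T):\det(A)\in U(T)\}$. *)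

(* Defs.v *)
From HB Require Import structures.
From mathcomp Require Import all_boot all_order all_algebra.

Set Implicit Arguments.
Unset Strict Implicit.
Unset Printing Implicit Defensive.
Import GRing.Theory.
Local Open Scope ring_scope.
Local Open Scope quotient_scope.

Section Ideals.
Variable R : finComUnitRingType.
Implicit Types (I J : {set R}) (a : R).

(* The library's [idealr_closed], without the requirement that I be proper. *)
Definition ideal I : Prop :=
  0 \in I /\ forall a, {in I &, forall u v, a * u + v \in I}.

Definition maximal_ideal I : Prop :=
  [/\ ideal I, I != setT &
      forall J, ideal J -> I \subset J -> J = I \/ J = setT].

Definition chain_ring : Prop :=
  forall I J, ideal I -> ideal J -> I \subset J \/ J \subset I.

Definition principal a : {set R} := [set a * x | x : R].

End Ideals.

Definition nilpotency_index (R : finComUnitRingType) (a : R) (e : nat) : Prop :=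
  [/\ (0 < e)%N, a ^+ e = 0 &
      forall k, (0 < k)%N -> a ^+ k = 0 -> (e <= k)%N].

(* The ring R / aR. The library puts a ring structure on the additive quotient
   [Quotient.quot] only for proper ideals; allowing the zero ring instead makes
   R / aR available for every a. *)
Section PrincipalQuotient.
Variables (R : finComUnitRingType) (a : R).

Definition in_principal : {pred R} := fun x => x \in principal a.

Lemma in_principal_zmod_closed : zmod_closed in_principal.
Proof.
split=> [|_ _ /imsetP[x _ ->] /imsetP[y _ ->]]; apply/imsetP.
  by exists 0; rewrite ?mulr0.
by exists (x - y); rewrite ?mulrBr.
Qed.

HB.instance Definition _ :=
  GRing.isZmodClosed.Build R in_principal in_principal_zmod_closed.

Lemma in_principalM x y : y \in in_principal -> x * y \in in_principal.
Proof.
case/imsetP=> z _ ->; apply/imsetP.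
by exists (x * z); rewrite // mulrCA.
Qed.

Definition quot_ring := Quotient.quot in_principal.

HB.instance Definition _ := GRing.Zmodule.on quot_ring.
HB.instance Definition _ := EqQuotient.on quot_ring.
HB.instance Definition _ : isCountable quot_ring :=
  CanIsCountable (@reprK _ quot_ring).
HB.instance Definition _ : isFinite quot_ring :=
  isFinite.Build quot_ring (pcan_enumP (can_pcan (@reprK _ quot_ring))).

Definition quot_one : quot_ring := \pi_quot_ring 1.
Definition quot_mul := lift_op2 quot_ring *%R.

Lemma pi_quot_eq (x y : R) :
  (\pi_quot_ring x = \pi_quot_ring y) <-> (x - y \in in_principal).
Proof.
by rewrite (Quotient.idealrBE in_principal); split=> [->|/eqP].
Qed.

Lemma pi_quot_add (x y : R) :
  \pi_quot_ring (x + y) = \pi_quot_ring x + \pi_quot_ring y.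
Proof. exact: Quotient.pi_add. Qed.

Lemma pi_quot_mul (x y : R) :
  \pi_quot_ring (x * y) = quot_mul (\pi_quot_ring x) (\pi_quot_ring y).
Proof.
have piB z : z - repr (\pi_quot_ring z) \in in_principal.
  by apply/pi_quot_eq; rewrite [RHS]reprK.
unlock quot_mul; apply/pi_quot_eq; set x' := repr _; set y' := repr _.
rewrite -[x * y](addrNK (x * y')) -mulrBr -addrA -mulrBl rpredD //.
  exact/in_principalM/piB.
by rewrite mulrC; exact/in_principalM/piB.
Qed.

Lemma quot_mulA : associative quot_mul.
Proof.
move=> x y z; rewrite -[x]reprK -[y]reprK -[z]reprK.
by rewrite -!pi_quot_mul mulrA.
Qed.

Lemma quot_mulC : commutative quot_mul.
Proof. by move=> x y; rewrite -[x]reprK -[y]reprK -!pi_quot_mul mulrC. Qed.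

Lemma quot_mul1 : left_id quot_one quot_mul.
Proof. by move=> x; rewrite -[x]reprK -pi_quot_mul mul1r. Qed.

Lemma quot_mulDl : left_distributive quot_mul +%R.
Proof.
move=> x y z; rewrite -[x]reprK -[y]reprK -[z]reprK.
by rewrite -pi_quot_add -!pi_quot_mul -pi_quot_add mulrDl.
Qed.

HB.instance Definition _ := GRing.Zmodule_isComPzRing.Build quot_ring
  quot_mulA quot_mulC quot_mul1 quot_mulDl.

End PrincipalQuotient.

Definition sym_tridiag (T : comPzRingType) n (A : 'M[T]_n) : bool :=
  (A^T == A) &&
  [forall i : 'I_n, forall j : 'I_n, ((i.+1 < j) || (j.+1 < i))%N ==> (A i j == 0)].

Definition ST (T : finComPzRingType) n : {set 'M[T]_n} :=
  [set A | sym_tridiag A].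

Definition STdet (T : finComPzRingType) n (c : T) : {set 'M[T]_n} :=
  [set A in ST T n | \det A == c].

Definition IST (T : finComUnitRingType) n : {set 'M[T]_n} :=
  [set A in ST T n | \det A \is a GRing.unit].

(* Main.v *)
(** The sum telescopes: with [a_s = q^((e-s)(2n-1)) |ST_n(R/gamma^s,0)|] it is
    [a_1 - a_e]. Reduction modulo [gamma^s] shows that [a_s] counts the matrices
    of [ST_n(R)] whose determinant lies in [gamma^s R]. Hence
    [a_e = |ST_n(R,0)|], while [a_1] counts the matrices with nonunit
    determinant, because [R] is local. *)
Require Import Defs.
From HB Require Import structures.
From mathcomp Require Import all_boot all_order all_algebra.
From mathcomp Require Import zify.

Set Implicit Arguments.
Unset Strict Implicit.
Unset Printing Implicit Defensive.
Import GRing.Theory.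
Local Open Scope ring_scope.
Local Open Scope quotient_scope.

(** The hypothesis makes each fibre of [f] on [A] a coset [x + K]. Neither additivity of [f] nor
    closure of [A] under addition is asked for: matrices with determinant in a given ideal need not
    form a subgroup. *)
Lemma card_translation_fibers (S : finZmodType) (T : finType) (f : S -> T)
    (A K : {set S}) :
  (forall x y, x \in A -> (y \in A) && (f y == f x) = (y - x \in K)) ->
  #|A| = (#|f @: A| * #|K|)%N.
Proof.
move=> fK; rewrite -sum1_card (partition_big_imset f) /=.
rewrite (eq_bigr (fun=> #|K|)) ?sum_nat_const // => _ /imsetP[x Ax ->].
rewrite sum1dep_card -(card_imset K (addrI x)); apply: eq_card => y.
rewrite inE fK //; apply/idP/imsetP => [Kyx | [k Kk ->]].
  by exists (y - x); rewrite // addrC subrK.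
by rewrite addrC addKr.
Qed.

(** * Principal ideals, and locality of chain rings *)

Section PrincipalIdeals.
Variable R : finComUnitRingType.
Implicit Types a x y : R.

Lemma principalP a x : reflect (exists y, x = a * y) (x \in principal a).
Proof. by apply: (iffP imsetP) => [[y _ ->]|[y ->]]; exists y. Qed.

Lemma principal_ideal a : ideal (principal a).
Proof.
split=> [|b _ _ /principalP[u ->] /principalP[v ->]]; apply/principalP.
  by exists 0; rewrite mulr0.
by exists (b * u + v); rewrite mulrDr mulrCA.
Qed.

Lemma principal_id a : a \in principal a.
Proof. by apply/principalP; exists 1; rewrite mulr1. Qed.

Lemma principalT a : (principal a == setT) = (a \is a GRing.unit).
Proof.
apply/eqP/idP => [aT | Ua].
  have /principalP[y y1] : 1 \in principal a by rewrite aT inE.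
  by apply/unitrPr; exists y.
by apply/setP => x; rewrite inE; apply/principalP; exists (a^-1 * x); rewrite mulVKr.
Qed.

Lemma principal0 : principal (0 : R) = [set 0].
Proof.
apply/setP => x; rewrite inE; apply/principalP/eqP => [[y ->]|->].
  by rewrite mul0r.
by exists 0; rewrite mulr0.
Qed.

(** If [x] lies outside [aR], comparability forces [aR] inside [xR]; by maximality [xR] is [aR],
    which is absurd, or the whole ring. *)
Lemma chain_ring_unitE a x : chain_ring R -> maximal_ideal (principal a) ->
  (x \is a GRing.unit) = (x \notin principal a).
Proof.
move=> Rch [_ aNT amax]; apply/idP/idP => [Ux | xNa].
  apply: contra aNT => /principalP[y xE]; move: Ux.
  by rewrite xE unitrM principalT => /andP[].
have [/subsetP xa | ax] := Rch _ _ (principal_ideal x) (principal_ideal a).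
  by rewrite xa ?principal_id in xNa.
have [xE | xT] := amax _ (principal_ideal x) ax.
  by rewrite -xE principal_id in xNa.
by rewrite -principalT xT.
Qed.

End PrincipalIdeals.

(** * Reduction modulo a principal ideal *)

Section Reduction.
Variables (R : finComUnitRingType) (a : R).

(** A named projection can carry the ring morphism structure that [det_map_mx] relies on. *)
Definition reduce (x : R) : quot_ring a := \pi_(quot_ring a) x.

Lemma reduce_zmod_morphism : zmod_morphism reduce.
Proof. by move=> x y; exact: raddfB. Qed.

Lemma reduce_monoid_morphism : monoid_morphism reduce.
Proof. by split=> // x y; exact: pi_quot_mul. Qed.

HB.instance Definition _ :=
  GRing.isZmodMorphism.Build R (quot_ring a) reduce reduce_zmod_morphism.
HB.instance Definition _ :=
  GRing.isMonoidMorphism.Build R (quot_ring a) reduce reduce_monoid_morphism.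

Lemma reduce_eq x y : (reduce x == reduce y) = (x - y \in principal a).
Proof. by apply/eqP/idP => /pi_quot_eq. Qed.

Lemma reduce_eq0 x : (reduce x == 0) = (x \in principal a).
Proof. by rewrite -(rmorph0 reduce) reduce_eq subr0. Qed.

Lemma reprK_reduce : cancel repr reduce.
Proof. exact: reprK. Qed.

Lemma card_quot_ring : #|R| = (#|{: quot_ring a}| * #|principal a|)%N.
Proof.
rewrite -cardsT (@card_translation_fibers _ _ reduce setT (principal a)).
  congr (_ * _)%N; rewrite -cardsT; congr #|pred_of_set _|.
  apply/setP => x; rewrite inE; apply/imsetP.
  by exists (repr x); rewrite ?reprK_reduce.
by move=> x y _; rewrite inE reduce_eq.
Qed.

End Reduction.

(** * Sizes of the ideals generated by powers of [gamma] *)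

Section ChainRing.
Variables (R : finComUnitRingType) (gamma : R).
Hypothesis R_chain : chain_ring R.
Hypothesis gamma_max : maximal_ideal (principal gamma).
Let q := #|{: quot_ring gamma}|.

(* [x |-> b x] maps [R] onto [bR] and [gamma R] onto [b gamma R] with the same
   kernel, since [b != 0] is not annihilated by a unit. *)
Lemma card_principalM (b : R) : b != 0 ->
  #|principal b| = (q * #|principal (b * gamma)%R|)%N.
Proof.
move=> b0; pose K := [set x | b * x == 0].
have cR : #|R| = (#|principal b| * #|K|)%N.
  rewrite -cardsT (@card_translation_fibers _ _ ( *%R b) setT K).
    congr (_ * _)%N; apply: eq_card => x.
    by apply/imsetP/principalP => [[y _ ->]|[y ->]]; exists y.
  by move=> x y _; rewrite !inE mulrBr subr_eq0.
have K_gamma x : x \in K -> x \in principal gamma.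
  rewrite inE; apply: contraLR; rewrite -chain_ring_unitE // => Ux.
  by apply: contra b0 => /eqP bx0; rewrite -(mulrK Ux b) bx0 mul0r.
have cG : #|principal gamma| = (#|principal (b * gamma)%R| * #|K|)%N.
  rewrite (@card_translation_fibers _ _ ( *%R b) (principal gamma) K).
    congr (_ * _)%N; apply: eq_card => x.
    apply/imsetP/principalP => [[_ /principalP[y ->] ->] | [y ->]].
      by exists y; rewrite mulrA.
    by exists (gamma * y); rewrite ?mulrA //; apply/principalP; exists y.
  move=> x y xg; apply/andP/idP => [[_ /eqP bxy]|Kyx].
    by rewrite inE mulrBr bxy subrr.
  split; last by rewrite inE mulrBr subr_eq0 in Kyx.
  have [_ /(_ 1) gD] := principal_ideal gamma.
  by have := gD _ _ (K_gamma _ Kyx) xg; rewrite mul1r subrK.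
have K0 : (0 < #|K|)%N by apply/card_gt0P; exists 0; rewrite inE mulr0.
(* Cancel [#|K|] in [|bR| |K| = |R| = q |gamma R| = q |b gamma R| |K|]. *)
by apply/eqP; rewrite -(eqn_pmul2r K0) -mulnA -cG -cR (card_quot_ring gamma).
Qed.

(** Induction climbs from the zero ideal [gamma^e R], gaining a factor [q] each time the exponent
    drops by one. *)
Lemma card_principalX (e k : nat) : nilpotency_index gamma e -> (k <= e)%N ->
  #|principal (gamma ^+ (e - k))| = (q ^ k)%N.
Proof.
move=> [e0 ge emin]; elim: k => [|k IH] ke.
  by rewrite subn0 ge principal0 cards1.
rewrite card_principalM.
  by rewrite -exprSr subnSK // IH ?expnS // ltnW.
(* Minimality of [e] speaks of positive exponents only; exponent 0 gives [1 != 0]. *)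
case: (posnP (e - k.+1)) => [->|j0]; first by rewrite expr0 oner_eq0.
apply/eqP => gj; have := emin _ j0 gj; lia.
Qed.

End ChainRing.

(** * Counting symmetric tridiagonal matrices *)

Section SymmetricTridiagonal.

(** By symmetry, it suffices to ask for zeros above the superdiagonal. *)
Lemma STP (T : finComPzRingType) n (A : 'M[T]_n) :
  reflect ((forall i j, A i j = A j i) /\
           forall i j : 'I_n, (i.+1 < j)%N -> A i j = 0)
          (A \in ST T n).
Proof.
rewrite inE; apply: (iffP andP) => [[/eqP At /forallP A0]|[At A0]].
  split=> [i j|i j ij]; first by rewrite -[in LHS]At mxE.
  by have /forallP/(_ j) := A0 i; rewrite ij => /eqP.
split; first by apply/eqP/matrixP => i j; rewrite mxE At.
apply/forallP => i; apply/forallP => j; apply/implyP => /orP[ij|ji].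
  by rewrite A0.
by rewrite At A0.
Qed.

Lemma ST_sub (T : finComPzRingType) n (A B : 'M[T]_n) :
  A \in ST T n -> (B \in ST T n) = (B - A \in ST T n).
Proof.
move=> /STP[At A0]; apply/STP/STP => -[Bt B0]; split=> i j.
- by rewrite !mxE At Bt.
- by move=> ij; rewrite !mxE A0 // B0 // subrr.
- by have := Bt i j; rewrite !mxE At => /addIr.
- by move=> ij; have := B0 i j ij; rewrite !mxE A0 // subr0.
Qed.

Lemma ST_map (T T' : finComPzRingType) (f : T -> T') n (A : 'M[T]_n) :
  f 0 = 0 -> A \in ST T n -> map_mx f A \in ST T' n.
Proof.
move=> f0 /STP[At A0]; apply/STP; split=> i j; first by rewrite !mxE At.
by move=> ij; rewrite mxE A0.
Qed.

(* A position [(i, j)] on the three central diagonals is determined, up to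
   symmetry, by [i + j], which ranges over [0 .. 2n - 2]. *)
Lemma card_ST_in (T : finComPzRingType) n (I : {set T}) : (0 < n)%N -> 0 \in I ->
  #|[set A in ST T n | [forall i, forall j, A i j \in I]]| =
  (#|I| ^ (2 * n - 1))%N.
Proof.
case: n => // n _ I0.
have -> : (2 * n.+1 - 1)%N = (2 * n).+1 by lia.
rewrite -[(2 * n).+1 in RHS]card_ord -card_ffun_on.
pose F (f : {ffun 'I_(2 * n).+1 -> T}) : 'M[T]_n.+1 := \matrix_(i, j)
  if ((i <= j.+1) && (j <= i.+1))%N then f (inord (i + j)) else 0.
(* The position [(k./2, uphalf k)] is the one on the diagonal or superdiagonal whose coordinates sum
   to [k]. *)
pose G (A : 'M[T]_n.+1) : {ffun 'I_(2 * n).+1 -> T} :=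
  [ffun k : 'I_(2 * n).+1 => A (inord k./2) (inord (uphalf k))].
have FK : cancel F G.
  move=> f; apply/ffunP => k; rewrite ffunE mxE.
  have k_m : (k < (2 * n).+1)%N := ltn_ord k.
  have [k_half k_uphalf] : (k./2 < n.+1 /\ uphalf k < n.+1)%N.
    by split; lia.
  rewrite !inordK // ifT; last by lia.
  by congr (f _); apply: val_inj; rewrite /= inordK; lia.
rewrite -(card_imset _ (can_inj FK)); apply: eq_card => A.
rewrite inE; apply/andP/imsetP => [[/STP[At A0] /forallP AI]|[f fI ->]].
  exists (G A).
    by apply/ffun_onP => k; rewrite ffunE; apply: (forallP (AI _)).
  apply/matrixP => i j; rewrite mxE; case: ifP => [/andP[ij ji]|ij_far].
    have [i_n j_n] : (i < n.+1 /\ j < n.+1)%N by [].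
    rewrite ffunE inordK; last by lia.
    (* [G] never reads the subdiagonal, so an entry there is first transposed. *)
    have [le_ij|lt_ji] := leqP i j.
      by congr (A _ _); apply: val_inj; rewrite /= inordK; lia.
    by rewrite At; congr (A _ _); apply: val_inj; rewrite /= inordK; lia.
  have [/A0 //|ij] := ltnP i.+1 j.
  by rewrite At A0 //; lia.
split.
  apply/STP; split=> i j; rewrite !mxE; first by rewrite andbC addnC.
  by move=> ij; rewrite ifF //; lia.
apply/forallP => i; apply/forallP => j; rewrite mxE; case: ifP => // _.
exact: (ffun_onP fI).
Qed.

Lemma card_ST (T : finComPzRingType) n : (0 < n)%N ->
  #|ST T n| = (#|T| ^ (2 * n - 1))%N.
Proof.
move=> n0; rewrite -cardsT -card_ST_in ?inE //; apply: eq_card => A.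
by rewrite [RHS]inE andb_idr // => _; apply/'forall_forallP => i j; rewrite inE.
Qed.

(** The determinant commutes with entrywise reduction, which is therefore onto the matrices of
    determinant 0 over [R / aR]; its fibres are cosets of the symmetric tridiagonal matrices with
    entries in [aR]. *)
Lemma card_ST_det_principal (R : finComUnitRingType) (a : R) n : (0 < n)%N ->
  #|[set A in ST R n | \det A \in principal a]| =
  (#|STdet n (0 : quot_ring a)%R| * #|principal a| ^ (2 * n - 1))%N.
Proof.
move=> n0; rewrite -(card_ST_in n0 (proj1 (principal_ideal a))).
set K := [set A in ST R n | [forall i, forall j, _]].
rewrite (@card_translation_fibers _ _ (map_mx (reduce a)) _ K).
  congr (_ * _)%N; apply: eq_card => B.
  apply/imsetP/idP => [[A] | ].
    rewrite inE => /andP[AST detA] ->.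
    by rewrite inE ST_map ?rmorph0 //= det_map_mx reduce_eq0.
  rewrite inE => /andP[BST /eqP detB].
  (* [repr] need not send 0 to 0, which would spoil the zero pattern. *)
  pose lift0 (x : quot_ring a) : R := if x == 0 then 0 else repr x.
  have lift0K : cancel lift0 (reduce a).
    move=> x; rewrite /lift0; case: eqP => [->|_]; first exact: rmorph0.
    exact: reprK_reduce.
  have BE : B = map_mx (reduce a) (map_mx lift0 B).
    by apply/matrixP => i j; rewrite !mxE lift0K.
  exists (map_mx lift0 B) => //.
  rewrite inE ST_map //=; last by rewrite /lift0 eqxx.
  by rewrite -reduce_eq0 -det_map_mx -BE detB.
move=> A B; rewrite inE => /andP[AST detA]; apply/andP/idP => [[]|].
  rewrite inE => /andP[BST _] /eqP AB.
  rewrite inE -ST_sub // BST; apply/'forall_forallP => i j.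
  by have /matrixP/(_ i j)/eqP := AB; rewrite !mxE reduce_eq.
rewrite inE -ST_sub // => /andP[BST /'forall_forallP BAI].
(* Congruent matrices have congruent determinants, so the determinant condition passes from [A] to
   [B]. *)
have AB : map_mx (reduce a) B = map_mx (reduce a) A.
  apply/matrixP => i j; apply/eqP; rewrite !mxE reduce_eq.
  by have := BAI i j; rewrite !mxE.
split; last exact/eqP.
by rewrite inE BST -reduce_eq0 -det_map_mx AB det_map_mx reduce_eq0.
Qed.

End SymmetricTridiagonal.

Theorem theorem3p14 (R : finComUnitRingType) (gamma : R) (e q n : nat)
    (R_chain : chain_ring R)
    (gamma_max : maximal_ideal (principal gamma))
    (gamma_e : nilpotency_index gamma e)
    (card_residue : #|{: quot_ring gamma}| = q)
    (n_gt0 : (0 < n)%N) :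
  #|STdet n (0 : R)|%:Z =
    (q ^ (e * (2 * n - 1)))%:Z - #|IST R n|%:Z
    - \sum_(1 <= s < e)
        ((q ^ ((e - s) * (2 * n - 1)) *
            #|STdet n (0 : quot_ring (gamma ^+ s))|)%:Z
         - (q ^ ((e - s - 1) * (2 * n - 1)) *
            #|STdet n (0 : quot_ring (gamma ^+ s.+1))|)%:Z).
Proof.
have [e_gt0 ge0 _] := gamma_e.
pose a s := #|[set A in ST R n | \det A \in principal (gamma ^+ s)]|.
have aE s : (s <= e)%N ->
    (q ^ ((e - s) * (2 * n - 1)) *
       #|STdet n (0 : quot_ring (gamma ^+ s))%R|)%N = a s.
  move=> se; rewrite /a card_ST_det_principal // mulnC expnM; congr (_ * _ ^ _)%N.
  (* The factor [q ^ (e - s)] is the size of [gamma^s R]. *)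
  rewrite -card_residue -(card_principalX R_chain gamma_max gamma_e) ?leq_subr //.
  by rewrite subKn.
(* The sign is pulled out to get the increasing differences of [telescope_sumr]. *)
rewrite (eq_big_nat _ _ (F2 := fun s => - ((a s.+1)%:Z - (a s)%:Z))); last first.
  by move=> s /andP[_ se]; rewrite -subnDA addn1 !aE ?opprB // ltnW.
rewrite sumrN telescope_sumr // opprK.
have -> : #|STdet n (0 : R)| = a e.
  by apply: eq_card => A; rewrite !inE ge0 principal0 inE.
(* This is the case [k = e], where [gamma^0] generates all of [R]. *)
have cR : #|R| = (q ^ e)%N.
  rewrite -card_residue -(card_principalX R_chain gamma_max gamma_e) //.
  rewrite subnn expr0 -cardsT; congr #|pred_of_set _|.
  by apply/esym/eqP; rewrite principalT unitr1.
have := card_ST R n_gt0; rewrite cR -expnM => <-.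
rewrite -(cardsID [set A | \det A \is a GRing.unit] (ST R n)).
have -> : ST R n :&: [set A | \det A \is a GRing.unit] = IST R n.
  by apply/setP => A; rewrite !inE.
have -> : #|ST R n :\: [set A | \det A \is a GRing.unit]| = a 1%N.
  apply: eq_card => A; rewrite !inE expr1 andbC.
  by rewrite (chain_ring_unitE _ R_chain gamma_max) negbK.
by rewrite PoszD [X in X - _]addrC addrK addrC subrK.
Qed.
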